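(* Let $\mathcal{G}=(\mathcal{V},\mathcal{E},A)$ be a connected undirected weighted graph on $n$ nodes with $m$ edges $e_1,\dots,e_m$ (each given an arbitrary orientation), positive edge weights $a_1,\dots,a_m$, and incidence matrix $B\in\mathbb{R}^{n\times m}$. For each edge $e_k$ let $g_k:\mathbb{R}\to\mathbb{R}$ be an increasing (not necessarily continuous, not necessarily strictly increasing) odd function with $\lim_{y\to\infty}|g_k(y)|=\infty$. Consider the system $$\dot x_i=-\sum_{j=1}^n a_{ij}\,g_{ij}(x_i-x_j),\qquad i=1,\dots,n,$$ where $a_{ij}=a_{ji}=a_k$ and $g_{ij}=g_{ji}=g_k$ if $e_k$ is the edge joining $v_i$ and $v_j$ (and $a_{ij}=0$ if there is no such edge); equivalently, $\dot x=-B\,[a_1g_1(B_{\cdot,1}^\top x),\dots,a_mg_m(B_{\cdot,m}^\top x)]^\top$. Then every Filippov solution $x:[0,\infty)\to\mathbb{R}^n$ of this system converges asymptotically (as $t\to\infty$, in the sense that its distance to the set tends to $0$) to the set $$\mathcal{H}_1=\{x\in\mathbb{R}^n\mid 0\in\mathcal{F}[g_k](B_{\cdot,k}^\top x)\ \text{for all } k=1,\dots,m\}.$$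
   Context: Undirected weighted graph: symmetric adjacency matrix $A=[a_{ij}]$ with $a_{ij}\ge0$, $a_{ii}=0$. Incidence matrix $B$: the $(i,k)$ entry is $1$ if the (oriented) edge $e_k$ originates from $v_i$, $-1$ if it points towards $v_i$, and $0$ otherwise; $B_{\cdot,k}$ denotes the $k$-th column, so $B_{\cdot,k}^\top x=x_i-x_j$ if $e_k$ is oriented from $v_i$ to $v_j$. A function $g$ is odd if $g(y)=-g(-y)$ for all $y$. For a map $X:\mathbb{R}^p\to\mathbb{R}^p$ the Filippov set-valued map is $\mathcal{F}[X](x)=\bigcap_{\delta>0}\bigcap_{\mu(S)=0}\overline{\mathrm{co}}\{X(B(x,\delta)\setminus S)\}$, where here $B(x,\delta)$ is the open ball, $\mu$ is Lebesgue measure and $\overline{\mathrm{co}}$ is the closed convex hull. A Filippov solution of $\dot x=X(x)$ is a (locally) absolutely continuous function $x(t)$ with $\dot x(t)\in\mathcal{F}[X](x(t))$ for almost every $t$. *)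

(* Defs.v *)
From HB Require Import structures.
From mathcomp Require Import all_boot all_order all_algebra.
From mathcomp Require Import all_classical all_reals all_analysis.

Set Implicit Arguments.
Unset Strict Implicit.
Unset Printing Implicit Defensive.

Import Order.TTheory GRing.Theory Num.Theory.
Import numFieldNormedType.Exports.

Local Open Scope classical_set_scope.
Local Open Scope ring_scope.

(* The library norm on matrices is the max norm; this is the Euclidean one.
   Both induce the same topology, so [closure] and derivatives are unaffected. *)
Definition enorm (R : realType) (p : nat) (x : 'cV[R]_p) : R :=
  Num.sqrt (\sum_i x i 0 ^+ 2).

Definition eball (R : realType) (p : nat) (x : 'cV[R]_p) (delta : R) :
    set 'cV[R]_p :=
  [set y | enorm (y - x) < delta].

(* An infimum over the empty set is +oo. *)
Definition edist_set (R : realType) (p : nat) (H : set 'cV[R]_p)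
    (x : 'cV[R]_p) : \bar R :=
  ereal_inf [set (enorm (x - y))%:E | y in H].

Definition box (R : realType) (p : nat) (a b : 'cV[R]_p) : set 'cV[R]_p :=
  [set y | forall i, a i 0 <= y i 0 <= b i 0].

(* Lebesgue outer measure on R^p, as the library only provides the Lebesgue
   measure on R. Covers are at most countable: the predicate [P] selects the
   indices in use, so that the empty set has measure 0 even when p = 0. *)
Definition lebesgue_outer (R : realType) (p : nat) (S : set 'cV[R]_p) :
    \bar R :=
  ereal_inf [set v | exists (P : pred nat) (a b : nat -> 'cV[R]_p),
    [/\ forall k i, a k i 0 <= b k i 0,
        S `<=` \bigcup_(k in [set k | P k]) box (a k) (b k) &
        v = (\sum_(0 <= k <oo | P k) (\prod_i (b k i 0 - a k i 0))%:E)%E]].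

Definition closed_convex_hull (R : realType) (p : nat) (A : set 'cV[R]_p) :
    set 'cV[R]_p :=
  closure (smallest (fun C : set 'cV[R]_p => convex_set C) A).

(* Sets of Lebesgue measure zero are exactly those of outer measure zero. *)
Definition filippov (R : realType) (p : nat) (X : 'cV[R]_p -> 'cV[R]_p)
    (x : 'cV[R]_p) : set 'cV[R]_p :=
  \bigcap_(delta in [set d : R | 0 < d])
    \bigcap_(S in [set S : set 'cV[R]_p | lebesgue_outer S = 0%E])
      closed_convex_hull (X @` (eball x delta `\` S)).

(* A function R -> R as a map R^1 -> R^1. *)
Definition map1 (R : realType) (g : R -> R) : 'cV[R]_1 -> 'cV[R]_1 :=
  fun y => (g (y 0 0))%:M.

Definition abs_continuous_on (R : realType) (p : nat) (a b : R)
    (x : R -> 'cV[R]_p) : Prop :=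
  forall eps : R, 0 < eps -> exists2 delta : R, 0 < delta &
    forall (N : nat) (u v : 'I_N -> R),
      (forall i, [/\ a <= u i, u i <= v i & v i <= b]) ->
      trivIset setT (fun i => [set` `]u i, v i[]) ->
      \sum_i (v i - u i) < delta ->
      \sum_i enorm (x (v i) - x (u i)) < eps.

(* Solutions on [0, +oo); the values of [x] at negative times are irrelevant. *)
Definition filippov_solution (R : realType) (p : nat)
    (X : 'cV[R]_p -> 'cV[R]_p) (x : R -> 'cV[R]_p) : Prop :=
  (forall T : R, 0 < T -> abs_continuous_on 0 T x) /\
  {ae (@lebesgue_measure R), forall t : R, 0 < t ->
     derivable x t 1 /\ filippov X (x t) ('D_1 x t)}.

Definition is_adjacency (R : realType) (n : nat) (A : 'M[R]_n) : Prop :=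
  [/\ forall i j, A i j = A j i,
      forall i j, 0 <= A i j &
      forall i, A i i = 0].

Definition connected_graph (R : realType) (n : nat) (A : 'M[R]_n) : Prop :=
  forall i j : 'I_n, connect [rel u v | 0 < A u v] i j.

(* [src k] and [tgt k] are the ends of the k-th oriented edge: every edge is
   listed exactly once, with one of its two orientations. Its weight is
   [A (src k) (tgt k)]. *)
Definition is_orientation (R : realType) (n m : nat) (A : 'M[R]_n)
    (src tgt : 'I_m -> 'I_n) : Prop :=
  (forall k, 0 < A (src k) (tgt k)) /\
  (forall i j, 0 < A i j -> exists! k,
     (src k = i /\ tgt k = j) \/ (src k = j /\ tgt k = i)).

Definition incidence (R : realType) (n m : nat) (src tgt : 'I_m -> 'I_n) :
    'M[R]_(n, m) :=
  \matrix_(i, k) (if i == src k then 1 else if i == tgt k then -1 else 0).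

(* The values of [gn] on pairs that are not edges do not matter, since the
   weight is then 0. *)
Definition consensus_field (R : realType) (n : nat) (A : 'M[R]_n)
    (gn : 'I_n -> 'I_n -> R -> R) : 'cV[R]_n -> 'cV[R]_n :=
  fun x => \col_i (- \sum_j A i j * gn i j (x i 0 - x j 0)).

Definition setH1 (R : realType) (n m : nat) (B : 'M[R]_(n, m))
    (g : 'I_m -> R -> R) : set 'cV[R]_n :=
  [set x | forall k, filippov (map1 (g k)) ((col k B)^T *m x) 0].

(* Main.v *)
Require Import Defs.
From HB Require Import structures.
From mathcomp Require Import all_boot all_order all_algebra.
From mathcomp Require Import all_classical all_reals all_analysis.
From mathcomp Require Import ring lra.

(* The energy [W t = \sum_i x_i(t)^2] is a Lyapunov function. The coupling is
   antisymmetric, so along the flow [W'] is minus twice a sum over edges of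
   terms [a_k y_k xi_k] with [y_k] the gap of edge [k] and [xi_k] a value of [g_k]
   near [y_k]; each term is nonnegative since [g_k] is odd and increasing. Thus
   [x] is bounded, its velocity is bounded, and [x] is Lipschitz. The zero set of
   the Filippov map of [g_k] is an interval [-c_k, c_k]. If at time [t] some gap
   exceeds [c_k + 3 e], then by the Lipschitz bound it exceeds [c_k + 2 e] on a
   time interval of fixed length, over which [W] drops by a fixed amount; as [W]
   is nonincreasing and nonnegative, this happens at bounded times only.
   By compactness, gaps at most [c_k] up to a small error force a small
   distance to H_1. *)

Set Implicit Arguments.
Unset Strict Implicit.
Unset Printing Implicit Defensive.

Import Order.TTheory GRing.Theory Num.Theory.
Import numFieldNormedType.Exports.

Local Open Scope classical_set_scope.
Local Open Scope ring_scope.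

(** * Growth of absolutely continuous functions *)

Definition abs_continuous_real (R : realType) (a b : R) (f : R -> R) : Prop :=
  forall eps : R, 0 < eps -> exists2 delta : R, 0 < delta &
    forall (N : nat) (u v : 'I_N -> R),
      (forall i, [/\ a <= u i, u i <= v i & v i <= b]) ->
      trivIset setT (fun i => [set` `]u i, v i[]) ->
      \sum_i (v i - u i) < delta ->
      \sum_i `|f (v i) - f (u i)| < eps.

(** Brings the intervals recorded by Cousin's argument below into the indexed form used in the
    definition of absolute continuity. *)
Lemma pairwise_trivIset_oo (R : realType) (L : seq (R * R)) :
  pairwise (fun p q => p.2 <= q.1) L ->
  trivIset setT (fun i : 'I_(size L) =>
    [set` `](tnth (in_tuple L) i).1, (tnth (in_tuple L) i).2[]).
Proof.
move=> pL.
have key (i j : 'I_(size L)) z : (i < j)%N ->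
    z < (tnth (in_tuple L) i).2 -> (tnth (in_tuple L) j).1 < z -> False.
  move=> ij z1 z2; have /(pairwiseP (0, 0)) := pL.
  move=> /(_ i j); rewrite !inE !ltn_ord => /(_ isT isT ij) /=.
  rewrite !(tnth_nth (0, 0)) /= in z1 z2.
  by rewrite leNgt (lt_trans z2 z1).
move=> i j _ _ [z [/=]]; rewrite !in_itv/= => /andP[a1 a2] /andP[b1 b2].
by case: (ltngtP i j) => [ij|ij|/ord_inj//]; exfalso; apply: (key _ _ z ij).
Qed.

(** Induction on [L]: cut the first interval out of [O]. The later intervals start after its end, so
    they still lie in what is left. *)
Lemma sum_length_le_measure (R : realType) (L : seq (R * R)) (O : set R) :
  measurable O ->
  pairwise (fun p q => p.2 <= q.1) L ->
  (forall p, p \in L -> p.1 <= p.2 /\ `]p.1, p.2[%classic `<=` O) ->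
  ((\sum_(p <- L) (p.2 - p.1))%:E <= lebesgue_measure O)%E.
Proof.
elim: L O => [|p L IH] O mO; first by rewrite big_nil.
move=> /= /andP[/allP pL pwL] LO; rewrite big_cons.
have [p12 pO] := LO p (mem_head _ _).
have -> : lebesgue_measure O = (lebesgue_measure (O `\` `]p.1, p.2[%classic) +
    lebesgue_measure (O `&` `]p.1, p.2[%classic))%E by exact: measureDI.
rewrite addeC EFinD leeD//.
  rewrite setIidr// lebesgue_measure_itv /= lte_fin.
  case: ltP => [_ | p21]; first by rewrite EFinB.
  by rewrite lee_fin subr_le0.
apply: IH => //; first exact: measurableD.
move=> q qL; have [|q12 qO] := LO q; first by rewrite in_cons qL orbT.
split=> //.
move=> z zq; split; first exact: qO.
have := pL q qL; move: zq; rewrite /= !in_itv/= => /andP[qz _] pq /andP[_ zp].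
by move: (lt_le_trans zp pq); rewrite ltNge (ltW qz).
Qed.

(** The estimate is given on both sides of [t], so that adding the two bounds the increment over any
    short interval that contains [t]. *)
Lemma derivable_le_slope (R : realType) (f : R -> R) (t c : R) :
  derivable f t 1 -> 'D_1 f t < c ->
  exists2 d : R, 0 < d & forall s, `|s - t| < d ->
    (t <= s -> f s - f t <= c * (s - t)) /\
    (s <= t -> f t - f s <= c * (t - s)).
Proof.
move=> df dfc.
have cf : (h^-1 *: (f (h *: 1 + t) - f t) @[h --> 0^'] --> 'D_1 f t) by exact: df.
have /= [d /= d0 H] := cvgr_le _ cf _ dfc.
exists d => // s std; have [->|st] := eqVneq s t.
  by rewrite !subrr mulr0.
have := H (s - t); rewrite /= sub0r normrN => /(_ std).
rewrite subr_eq0 => /(_ st); rewrite /GRing.scale/= mulr1 subrK => q.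
split=> [ts|ts].
  have h0 : 0 < s - t by rewrite subr_gt0 lt_neqAle eq_sym st.
  by rewrite -ler_pdivrMr// mulrC.
have h0 : 0 < t - s by rewrite subr_gt0 lt_neqAle st.
by rewrite -ler_pdivrMr// mulrC -mulrNN -invrN !opprB.
Qed.

Lemma negligible_open_cover (R : realType) (N : set R) (e : R) :
  (@lebesgue_measure R).-negligible N -> 0 < e ->
  exists O : set R, [/\ open O, N `<=` O & (lebesgue_measure O < e%:E)%E].
Proof.
move=> [D [mD D0 ND]] e0.
have [|O [oO DO Oe]] := lebesgue_regularity_outer mD _ e0.
  by rewrite [X in (X < _)%E]D0.
exists O; split=> //; first exact: subset_trans ND DO.
have mO : measurable O by exact: measurable_realfun.open_measurable.
have -> : lebesgue_measure O = (lebesgue_measure (O `\` D) +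
    lebesgue_measure (O `&` D))%E by exact: measureDI.
rewrite (setIidr DO).
by rewrite [X in (_ + X)%E]D0 adde0.
Qed.

(* Cousin's argument: [b] is reached by steps that are tagged either by a point
   of differentiability, where the slope is controlled, or by a point of an
   exceptional open set; the steps of the second kind are recorded in [L]. *)
Lemma cousin_slope (R : realType) (a b c : R) (f : R -> R) (O : set R) :
  a <= b -> open O ->
  (forall t, a <= t <= b -> ~ O t -> derivable f t 1 /\ 'D_1 f t < c) ->
  exists L : seq (R * R), [/\ pairwise (fun p q => p.2 <= q.1) L,
    forall p, p \in L -> [/\ a <= p.1, p.1 <= p.2, p.2 <= b &
      `]p.1, p.2[%classic `<=` O] &
    f b - f a <= c * (b - a) +
      \sum_(p <- L) (`|f p.2 - f p.1| + `|c| * (p.2 - p.1))].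
Proof.
move=> ab oO Hf.
pose Q s := exists L : seq (R * R), [/\ pairwise (fun p q => p.2 <= q.1) L,
    forall p, p \in L -> [/\ a <= p.1, p.1 <= p.2, p.2 <= s &
      `]p.1, p.2[%classic `<=` O] &
    f s - f a <= c * (s - a) +
      \sum_(p <- L) (`|f p.2 - f p.1| + `|c| * (p.2 - p.1))].
suff : Q b by [].
(* Local extension around a tag [t]: a good point just left of [t] makes every point just right of
   [t] good. *)
have step t : a <= t <= b -> exists2 d : R, 0 < d &
    forall s s', a <= s -> s <= t <= s' -> t - d < s -> s' < t + d -> Q s -> Q s'.
  move=> tab; have [Ot|nOt] := pselect (O t).
    have [d /= d0 dO] := (nbhs_ballP _ _).1 (oO _ Ot).
    exists d => // s s' as_ /andP[st ts'] s1 s2 [L [pL LO Lf]].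
    exists (rcons L (s, s')); split.
    - rewrite pairwise_rcons pL andbT; apply/allP => p pL'.
      by case: (LO p pL').
    - move=> p; rewrite mem_rcons inE => /predU1P[->/=|pL'].
        split=> //; first exact: le_trans ts'.
        move=> z /=; rewrite in_itv/= => /andP[z1 z2]; apply: dO.
        by rewrite /ball/= ltr_norml; lra.
      case: (LO p pL') => p1 p2 p3 p4; split=> //.
      exact: le_trans p3 (le_trans st ts').
    - rewrite -cats1 big_cat big_seq1/=.
      set S := \sum_(p <- L) _ in Lf *.
      have h1 := ler_norm (f s' - f s).
      (* The main term [c * (s' - s)] may be negative; the summand in [|c|] of the recorded step
         makes up for it. *)
      have h2 : - `|c| * (s' - s) <= c * (s' - s).
        rewrite ler_wpM2r//; last by rewrite lerNl -normrN ler_norm.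
        by rewrite subr_ge0 (le_trans st).
      by lra.
  have [df dfc] := Hf _ tab nOt.
  have [d d0 dH] := derivable_le_slope df dfc.
  exists d => // s s' as_ /andP[st ts'] s1 s2 [L [pL LO Lf]].
  exists L; split=> //.
  - move=> p pL'; case: (LO p pL') => p1 p2 p3 p4; split=> //.
    exact: le_trans p3 (le_trans st ts').
  - have [_ /(_ st) h1] : _ := dH s ltac:(rewrite ltr_norml; lra).
    have [/(_ ts') h2 _] : _ := dH s' ltac:(rewrite ltr_norml; lra).
    by lra.
have Qa : Q a.
  by exists [::]; split=> //; rewrite big_nil !subrr mulr0 addr0.
pose E := [set s | a <= s <= b /\ Q s].
have Ea : E a by split=> //; rewrite lexx ab.
have ubE : ubound E b by move=> s [/andP[]].
have hsE : has_sup E by split; [exists a|exists b].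
pose t := sup E.
have atb : a <= t <= b.
  by rewrite /t ub_le_sup ?ge_sup//=; [exists a|case: hsE].
(* The supremum [t] of the good points is itself a tag, so goodness passes from some [s] just below
   [t] to points beyond [t], unless [t] is [b]. *)
have [d d0 dH] := step t atb.
have [s [/andP[as_ sb] Qs] ts] := sup_adherent d0 hsE.
have st : s <= t by apply: ub_le_sup; [case: hsE|split=> //; rewrite as_ sb].
have Qn s' : t <= s' -> s' < t + d -> Q s'.
  by move=> ts' s'd; apply: (dH s) => //; rewrite st ts'.
have [tb|tb] := ltP t b; last first.
  have -> : b = t by apply/eqP; rewrite eq_le tb; case/andP: atb.
  by apply: Qn => //; rewrite ltrDl.
exfalso; pose s' := Num.min b (t + d / 2).
have ts' : t < s' by rewrite lt_min tb ltrDl divr_gt0.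
have : E s'.
  split; last first.
    apply: Qn; first exact: ltW.
    by rewrite gt_min ltrD2l gtr_pMr// [X in _ || X](_ : _ = true) ?orbT//; lra.
  by rewrite ge_min lexx /= andbT (le_trans _ (ltW ts'))//; case/andP: atb.
by move/(ub_le_sup hsE.2); rewrite leNgt ts'.
Qed.

(** Enclose the exceptional times in an open set of small measure and apply [cousin_slope] with
    slope [c + e]. The recorded steps have small total length, hence by absolute continuity small
    total variation. This replaces integrating the derivative. *)
Lemma abs_continuous_real_growth (R : realType) (a b c : R) (f : R -> R) :
  a <= b -> abs_continuous_real a b f ->
  {ae (@lebesgue_measure R), forall t : R, a < t < b ->
     derivable f t 1 /\ 'D_1 f t <= c} ->
  f b - f a <= c * (b - a).
Proof.
move=> ab acf aef.
(* The endpoints join the exceptional set, as the hypothesis only concerns interior times. *)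
have neg : (@lebesgue_measure R).-negligible
    (~` [set t | a < t < b -> derivable f t 1 /\ 'D_1 f t <= c]
       `|` [set a; b]).
  apply: negligibleU; first exact: aef.
  by apply: negligibleU; apply/negligibleP => //; exact: lebesgue_measure_set1.
suff H e : 0 < e -> f b - f a <= (c + e) * (b - a) + e * (1 + `|c + e|).
  apply/ler_addgt0Pr => e e0.
  (* For [e' <= 1] the total error of the estimate is at most [e' * M]. *)
  pose M := b - a + 1 + (`|c| + 1).
  have M0 : 0 < M by rewrite /M; have := normr_ge0 c; lra.
  pose e' := Num.min 1 (e / M).
  have e'0 : 0 < e' by rewrite lt_min ltr01 divr_gt0.
  have e'1 : e' <= 1 by rewrite ge_min lexx.
  have e'M : e' * M <= e.
    by rewrite -ler_pdivlMr// ge_min lexx orbT.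
  apply: (le_trans (H _ e'0)).
  have h : `|c + e'| <= `|c| + 1.
    by rewrite (le_trans (ler_normD _ _))// lerD2l gtr0_norm.
  have hh : e' * (1 + `|c + e'|) <= e' * (1 + (`|c| + 1)).
    by rewrite ler_pM2l// lerD2l.
  by rewrite /M in e'M; lra.
move=> e0.
have [d d0 dH] := acf _ e0.
have [U [oU NU Ud]] :
    exists U : set R, [/\ open U,
      (~` [set t | a < t < b -> derivable f t 1 /\ 'D_1 f t <= c]
       `|` [set a; b]) `<=` U &
      (lebesgue_measure U < (Num.min d e)%:E)%E].
  by apply: negligible_open_cover => //; rewrite lt_min d0 e0.
have [|L [pL LU Lf]] := @cousin_slope R a b (c + e) f U ab oU.
  move=> t /andP[at_ tb] nUt.
  have ta : t != a by apply/eqP => ta; apply: nUt; apply: NU; right; left.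
  have tb' : t != b by apply/eqP => tb'; apply: nUt; apply: NU; right; right.
  have : [set t | a < t < b -> derivable f t 1 /\ 'D_1 f t <= c] t.
    by apply: contrapT => nt; apply: nUt; apply: NU; left.
  have atb : a < t < b by rewrite !lt_neqAle at_ tb tb' eq_sym ta.
  by move=> /(_ atb) [df dfc]; split=> //; rewrite (le_lt_trans dfc)// ltrDl.
have len : \sum_(p <- L) (p.2 - p.1) < Num.min d e.
  rewrite -lte_fin; apply: le_lt_trans Ud.
  apply: sum_length_le_measure => //.
    exact: measurable_realfun.open_measurable.
  by move=> p pL'; case: (LU p pL').
move: len; rewrite lt_min => /andP[lend lene].
have var : \sum_(p <- L) `|f p.2 - f p.1| < e.
  rewrite big_tnth; apply: dH; last by rewrite big_tnth in lend.
    by move=> i; case: (LU (tnth (in_tuple L) i)) => //; exact: mem_tnth.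
  exact: pairwise_trivIset_oo.
apply: (le_trans Lf); rewrite lerD2l big_split/= -mulr_sumr mulrDr mulr1.
by rewrite lerD ?(ltW var)// mulrC ler_wpM2r// ltW.
Qed.

(** * Filippov sets *)

Lemma continuous_sum (R : realType) (T : topologicalType) (I : finType)
    (F : I -> T -> R) :
  (forall i, continuous (F i)) -> continuous (fun x => \sum_i F i x).
Proof. by move=> cF; apply: continuous_big => //; exact: add_continuous. Qed.

(** A half-space is closed and convex. *)
Lemma closed_convex_hull_le (R : realType) (p : nat) (A : set 'cV[R]_p)
    (c : 'I_p -> R) (beta : R) :
  (forall w, A w -> \sum_i c i * w i 0 <= beta) ->
  forall v, closed_convex_hull A v -> \sum_i c i * v i 0 <= beta.
Proof.
move=> HA v.
pose H := [set w : 'cV[R]_p | \sum_i c i * w i 0 <= beta].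
have cH : closed H.
  apply: (@preimage_closed _ _ (fun w : 'cV[R]_p => \sum_i c i * w i 0)
    [set z | z <= beta]); last exact: closed_le.
  move=> w _; apply: continuous_sum => i {}w.
  apply: (@continuousM _ _ (fun=> c i) (fun z : 'cV[R]_p => z i 0)).
    exact: cst_continuous.
  exact: coord_continuous.
suff sub : closed_convex_hull A `<=` H by move=> /sub.
rewrite /closed_convex_hull.
apply: subset_trans (_ : closure H `<=` H); last by rewrite -((closure_id H).1 cH).
apply: closure_subset; apply: smallest_sub => // x y t.
rewrite !inE /H/= => xH yH.
rewrite (eq_bigr (fun i => t%:num * (c i * x i 0) + (1 - t%:num) * (c i * y i 0))).
  rewrite big_split/= -!mulr_sumr.
  have t0 : 0 <= t%:num by [].
  have t1 : 0 <= 1 - t%:num by rewrite subr_ge0.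
  apply: (le_trans (lerD (ler_wpM2l t0 xH) (ler_wpM2l t1 yH))).
  by rewrite -mulrDl subrKC mul1r.
by move=> i _; rewrite !mxE mulrDr !(mulrCA (c i)).
Qed.

Lemma lebesgue_outer_set0 (R : realType) (p : nat) :
  lebesgue_outer (@set0 'cV[R]_p) = 0%E.
Proof.
apply/eqP; rewrite eq_le; apply/andP; split.
  apply: ereal_inf_lbound; exists pred0, (fun=> 0), (fun=> 0); split=> //.
  rewrite eseries_mkcond eseries0//.
apply: le_ereal_inf_tmp => _ [P [a [b [ab _ ->]]]].
apply: nneseries_ge0 => k _ _; rewrite lee_fin.
by apply: prodr_ge0 => i _; rewrite subr_ge0.
Qed.

(** Intersecting over all radii and null sets allows picking this [delta] and the empty null set.
    All upper estimates on Filippov values below come from this linear bound. *)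
Lemma filippov_le (R : realType) (p : nat) (X : 'cV[R]_p -> 'cV[R]_p)
    (x v : 'cV[R]_p) (delta : R) (c : 'I_p -> R) (beta : R) :
  0 < delta ->
  (forall z, eball x delta z -> \sum_i c i * X z i 0 <= beta) ->
  filippov X x v -> \sum_i c i * v i 0 <= beta.
Proof.
move=> d0 H /(_ _ d0 set0 (lebesgue_outer_set0 R p)).
apply: closed_convex_hull_le => _ [z [xz _] <-]; exact: H.
Qed.

(** Otherwise []l, r[] would be covered by segments of total length below [r - l], against countable
    subadditivity of Lebesgue measure. *)
Lemma lebesgue_outer0_itv (R : realType) (S : set 'cV[R]_1) (l r : R) :
  lebesgue_outer S = 0%E -> l < r -> exists2 s, l < s < r & ~ S s%:M.
Proof.
move=> S0 lr; apply: contrapT => nS.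
have lrS s : l < s < r -> S s%:M.
  by move=> lsr; apply: contrapT => nSs; apply: nS; exists s.
have : (lebesgue_outer S < (r - l)%:E)%E by rewrite S0 lte_fin subr_gt0.
move=> /ereal_inf_lt[_ [P [a [b [ab cov ->]]]]]; apply/negP; rewrite -leNgt.
have -> : (r - l)%:E = lebesgue_measure `]l, r[%classic.
  by rewrite lebesgue_measure_itv/= lte_fin lr EFinB.
pose A k := if P k then `[a k 0 0, b k 0 0]%classic else set0.
have -> : (\sum_(0 <= k <oo | P k) (\prod_i (b k i 0 - a k i 0))%:E =
    \sum_(0 <= k <oo) lebesgue_measure (A k))%E.
  rewrite eseries_mkcond; apply: eq_eseriesr => k _; rewrite /A.
  case: ifPn => _; last by rewrite measure0.
  rewrite big_ord1 lebesgue_measure_itv/= lte_fin.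
  have := ab k 0; rewrite le_eqVlt => /predU1P[->|->]; last by rewrite EFinB.
  by rewrite subrr ltxx.
apply: measure_sigma_subadditive => //.
  by move=> k; rewrite /A; case: ifP.
move=> s; rewrite /= in_itv/= => /lrS /cov[k /= Pk /(_ 0)].
by rewrite mxE eqxx mulr1n => abs; exists k => //; rewrite /A Pk/= in_itv/=.
Qed.

(** On each side of [y] some point close to [y] avoids the null set; the values of [g] there have
    opposite weak signs, so 0 is a convex combination of them. *)
Lemma filippov_map1_0 (R : realType) (g : R -> R) (y : 'cV[R]_1) :
  (forall s, s < y 0 0 -> g s <= 0) -> (forall s, y 0 0 < s -> 0 <= g s) ->
  filippov (map1 g) y 0.
Proof.
move=> gl gr d /= d0 S /= S0; apply: subset_closure => C [cC AC].
have ball_y s : y 0 0 - d < s < y 0 0 + d -> eball y d s%:M.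
  move=> sd; rewrite /eball/= /enorm big_ord1 !mxE eqxx mulr1n sqrtr_sqr.
  by rewrite ltr_norml; lra.
have inC s : y 0 0 - d < s < y 0 0 + d -> ~ S s%:M -> C (g s)%:M.
  move=> sd nSs; apply: AC; exists s%:M; first by split=> //; exact: ball_y.
  by rewrite /map1 mxE eqxx mulr1n.
have [s1 s1d nS1] := @lebesgue_outer0_itv _ _ (y 0 0 - d) (y 0 0) S0
  ltac:(lra).
have [s2 s2d nS2] := @lebesgue_outer0_itv _ _ (y 0 0) (y 0 0 + d) S0
  ltac:(lra).
have g1 : g s1 <= 0 by apply: gl; lra.
have g2 : 0 <= g s2 by apply: gr; lra.
have C1 : C (g s1)%:M by apply: inC => //; lra.
have C2 : C (g s2)%:M by apply: inC => //; lra.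
have [g10|g1n] := eqVneq (g s1) 0.
  by move: C1; rewrite g10 raddf0.
have D0 : 0 < g s2 - g s1 by rewrite subr_gt0 (lt_le_trans _ g2)// lt_neqAle g1n.
(* This is the weight of [g s1] in the combination that vanishes. *)
have t0 : 0 <= g s2 / (g s2 - g s1) by rewrite divr_ge0// ltW.
have t1 : g s2 / (g s2 - g s1) <= 1 by rewrite ler_pdivrMr// mul1r; lra.
have := cC (g s1)%:M (g s2)%:M (Itv01 t0 t1) (mem_set C1) (mem_set C2).
rewrite inE; congr (C _); apply/matrixP => i j; rewrite !mxE/= !ord1 eqxx !mulr1n.
by rewrite /unstable.onem; field; rewrite gt_eqF.
Qed.

(** * The consensus field *)

Lemma coord_le_enorm (R : realType) (p : nat) (y : 'cV[R]_p) (i : 'I_p) :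
  `|y i 0| <= enorm y.
Proof.
rewrite -sqrtr_sqr ler_wsqrtr// (bigD1 i)//= lerDl.
by apply: sumr_ge0 => j _; exact: sqr_ge0.
Qed.

Lemma enorm_le_sum (R : realType) (p : nat) (y : 'cV[R]_p) :
  enorm y <= \sum_i `|y i 0|.
Proof.
have S0 : 0 <= \sum_i `|y i 0| by exact: sumr_ge0.
rewrite /enorm -(ger0_norm S0) -sqrtr_sqr ler_wsqrtr// expr2 mulr_suml.
apply: ler_sum => i _; rewrite -real_normK ?num_real// expr2.
by rewrite ler_wpM2l// (bigD1 i)//= lerDl sumr_ge0.
Qed.

Lemma eball_coord (R : realType) (p : nat) (x z : 'cV[R]_p) (d : R) (i : 'I_p) :
  eball x d z -> `|z i 0 - x i 0| < d.
Proof.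
by apply: le_lt_trans; have := coord_le_enorm (z - x) i; rewrite !mxE.
Qed.

Section symmetric_coupling.
Variables (R : realType) (n : nat) (A : 'M[R]_n) (gn : 'I_n -> 'I_n -> R -> R).
Hypotheses (hA : is_adjacency A)
  (gn_sym : forall i j, 0 < A i j -> gn i j = gn j i)
  (gn_homo : forall i j, 0 < A i j -> {homo gn i j : y z / y <= z})
  (gn_odd : forall i j, 0 < A i j -> forall y, gn i j (- y) = - gn i j y).
Local Notation X := (consensus_field A gn).

Lemma gn0 i j : 0 < A i j -> gn i j 0 = 0.
Proof. by move=> Aij; have := gn_odd Aij 0; rewrite oppr0 => ?; lra. Qed.

Lemma gn_ge0 i j y : 0 < A i j -> 0 <= y -> 0 <= gn i j y.
Proof. by move=> Aij y0; rewrite -(gn0 Aij) (gn_homo Aij). Qed.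

Lemma gn_le0 i j y : 0 < A i j -> y <= 0 -> gn i j y <= 0.
Proof. by move=> Aij y0; rewrite -(gn0 Aij) (gn_homo Aij). Qed.

(** Summation by parts on the graph. The weights [w] and the argument [z] are kept apart because a
    Filippov value at [x] samples the field at points [z] near [x], while the gradient of the energy
    is taken at [x]. *)
Lemma consensus_field_pairing (w z : 'cV[R]_n) :
  2 * (\sum_i w i 0 * X z i 0) =
  - \sum_i \sum_j A i j * ((w i 0 - w j 0) * gn i j (z i 0 - z j 0)).
Proof.
have [Asym A0 _] := hA.
pose S := \sum_i \sum_j A i j * (w i 0 * gn i j (z i 0 - z j 0)).
have -> : \sum_i w i 0 * X z i 0 = - S.
  rewrite /S -sumrN; apply: eq_bigr => i _; rewrite mxE mulrN mulr_sumr.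
  by congr (- _); apply: eq_bigr => j _; rewrite mulrCA.
(* Exchanging [i] and [j] flips the sign, by symmetry of [A] and [gn] and by oddness. *)
have S' : S = - \sum_i \sum_j A i j * (w j 0 * gn i j (z i 0 - z j 0)).
  rewrite /S exchange_big/= -sumrN; apply: eq_bigr => i _.
  rewrite -sumrN; apply: eq_bigr => j _; rewrite (Asym j i).
  have := A0 i j; rewrite le_eqVlt => /predU1P[<-|Aij].
    by rewrite !mul0r oppr0.
  rewrite -opprB -gn_sym// gn_odd// !mulrN //.
rewrite mulrN; congr (- _); rewrite mulrDl !mul1r {2}S' /S -sumrB.
apply: eq_bigr => i _; rewrite -sumrB; apply: eq_bigr => j _.
by rewrite mulrBl mulrBr.
Qed.

(** Every term of the double sum is nonnegative, so the single term at [(i0, j0)] bounds it from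
    below. *)
Lemma consensus_field_pairing_le (w z : 'cV[R]_n) (i0 j0 : 'I_n) (b : R) :
  (forall i j, 0 < A i j -> 0 <= (w i 0 - w j 0) * gn i j (z i 0 - z j 0)) ->
  b <= A i0 j0 * ((w i0 0 - w j0 0) * gn i0 j0 (z i0 0 - z j0 0)) ->
  \sum_i (2 * w i 0) * X z i 0 <= - b.
Proof.
move=> pos hb.
have [Asym A0 _] := hA.
have pos' i j : 0 <= A i j * ((w i 0 - w j 0) * gn i j (z i 0 - z j 0)).
  have := A0 i j; rewrite le_eqVlt => /predU1P[<-|Aij]; first by rewrite mul0r.
  by rewrite mulr_ge0// pos.
under eq_bigr do rewrite -mulrA.
rewrite -mulr_sumr consensus_field_pairing lerN2 (le_trans hb)//.
rewrite (bigD1 i0)//= (bigD1 j0)//= -addrA lerDl addr_ge0// sumr_ge0// => i _.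
by apply: sumr_ge0 => j _.
Qed.

(** If each coordinate moves by less than half the smallest nonzero gap of [x], no nonzero gap
    changes sign; a zero gap makes its term vanish. The default 1 of the minimum keeps [d] positive
    when all coordinates agree. *)
Lemma pairing_terms_ge0 (x : 'cV[R]_n) : exists2 d : R, 0 < d &
  forall z, eball x d z -> forall i j, 0 < A i j ->
    0 <= (x i 0 - x j 0) * gn i j (z i 0 - z j 0).
Proof.
pose d := \big[Num.min/1]_(q : 'I_n * 'I_n | x q.1 0 != x q.2 0)
  (`|x q.1 0 - x q.2 0| / 2).
exists d.
  apply: lt_bigmin => // q xq; by rewrite divr_gt0// normr_gt0 subr_eq0.
move=> z xz i j Aij.
have [->|xij] := eqVneq (x i 0) (x j 0); first by rewrite subrr mul0r.
have dle : d <= `|x i 0 - x j 0| / 2.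
  by apply: (@bigmin_le_cond _ _ _ _ (i, j)).
have := lt_le_trans (eball_coord i xz) dle.
have := lt_le_trans (eball_coord j xz) dle.
rewrite !ltr_norml => h1 h2.
have [s0|s0] := lerP 0 (x i 0 - x j 0).
  rewrite mulr_ge0// gn_ge0//; move: h1 h2; rewrite ger0_norm//; lra.
rewrite mulr_le0 ?(ltW s0)// gn_le0//; move: h1 h2; rewrite ltr0_norm//; lra.
Qed.

Lemma filippov_consensus_le0 (x v : 'cV[R]_n) :
  filippov X x v -> \sum_i (2 * x i 0) * v i 0 <= 0.
Proof.
have [d d0 hd] := pairing_terms_ge0 x.
apply: filippov_le d0 _ => z xz.
(* A diagonal pair [(n0, n0)] has a zero term and yields the bound 0; for [n = 0] the sum is
   empty. *)
have [n0 _|no] := pickP (fun _ : 'I_n => true); last first.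
  by rewrite big1// => i; have := no i.
rewrite -[leRHS]oppr0; apply: (@consensus_field_pairing_le _ _ n0 n0); first exact: hd.
by rewrite subrr mul0r mulr0.
Qed.

(** In a ball of radius at most [e / 2] the gap of the edge changes by less than [e], so it stays
    above [c + e] in size and monotonicity bounds the coupling there by its value at [c + e]. *)
Lemma filippov_consensus_dissipation (x v : 'cV[R]_n) (i j : 'I_n) (c e : R) :
  0 < A i j -> 0 <= c -> 0 < e -> c + e + e <= `|x i 0 - x j 0| ->
  filippov X x v ->
  \sum_i (2 * x i 0) * v i 0 <= - (A i j * ((c + e + e) * gn i j (c + e))).
Proof.
move=> Aij c0 e0 far; have [d d0 hd] := pairing_terms_ge0 x.
have de0 : 0 < Num.min d (e / 2) by rewrite lt_min d0 divr_gt0.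
apply: filippov_le de0 _ => z xz.
have hz : eball x d z by rewrite /eball/= (lt_le_trans xz)// ge_min lexx.
apply: (@consensus_field_pairing_le _ _ i j); first exact: hd.
rewrite ler_pM2l//.
have he : Num.min d (e / 2) <= e / 2 by rewrite ge_min lexx orbT.
have := lt_le_trans (eball_coord i xz) he.
have := lt_le_trans (eball_coord j xz) he.
rewrite !ltr_norml => h1 h2.
have gce : 0 <= gn i j (c + e) by rewrite gn_ge0//; lra.
have [s0|s0] := lerP 0 (x i 0 - x j 0).
  move: far; rewrite ger0_norm// => far.
  by rewrite ler_pM//; [lra|apply: gn_homo => //; lra].
move: far; rewrite ltr0_norm// => far.
rewrite -[leRHS]mulrNN -gn_odd//.
by rewrite ler_pM//; [lra|apply: gn_homo => //; lra].
Qed.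

Lemma consensus_field_bound (z : 'cV[R]_n) (r : R) (i : 'I_n) :
  (forall i, `|z i 0| <= r) ->
  `|X z i 0| <= \sum_j A i j * `|gn i j (r + r)|.
Proof.
move=> zr; have [Asym A0 _] := hA.
rewrite mxE normrN; apply: (le_trans (ler_norm_sum _ _ _)).
apply: ler_sum => j _.
have := A0 i j; rewrite le_eqVlt => /predU1P[<-|Aij].
  by rewrite !mul0r normr0.
rewrite normrM gtr0_norm// ler_pM2l//.
suff h : `|gn i j (z i 0 - z j 0)| <= gn i j (r + r).
  exact: le_trans h (ler_norm _).
have := zr i; have := zr j; rewrite !ler_norml -gn_odd// => h1 h2.
by apply/andP; split; apply: gn_homo => //; lra.
Qed.

(** On the ball of radius 1 coordinates are at most [r + 1] in size, so gaps are at most twice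
    that. *)
Lemma filippov_consensus_bound (x v : 'cV[R]_n) (r : R) (i : 'I_n) :
  (forall i, `|x i 0| <= r) -> filippov X x v ->
  `|v i 0| <= \sum_j A i j * `|gn i j ((r + 1) + (r + 1))|.
Proof.
move=> xr xv.
have zr z : eball x 1 z -> forall i, `|z i 0| <= r + 1.
  move=> xz {}i; have := xr i; have := eball_coord i xz.
  by rewrite ltr_norml !ler_norml; lra.
set M := \sum_j _.
(* The functionals [s * v i 0] with [s] equal to 1 and -1 together bound the absolute value. *)
have pick (s : R) (w : 'cV[R]_n) :
    \sum_k (if k == i then s else 0) * w k 0 = s * w i 0.
  rewrite (bigD1 i)//= eqxx big1 ?addr0// => k /negbTE ->.
  by rewrite mul0r.
have bound s : `|s| <= 1 -> s * v i 0 <= M.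
  move=> s1; rewrite -pick; apply: filippov_le ltr01 _ xv => z /zr hz.
  rewrite pick (le_trans (ler_norm _))// normrM.
  rewrite -[leRHS]mul1r ler_pM//; exact: consensus_field_bound.
rewrite ler_norml -(mul1r (v i 0)) bound ?normr1// andbT.
by rewrite lerNl -mulNr bound// normrN normr1.
Qed.

End symmetric_coupling.

(** * Filippov solutions *)

Lemma is_derive_coord (R : realType) (p : nat) (x : R -> 'cV[R]_p) (t : R)
    (i : 'I_p) :
  derivable x t 1 -> is_derive t (1 : R) (fun s => x s i 0) ('D_1 x t i 0).
Proof.
move=> dx.
have cx : (fun h : R => (h^-1 *: (x (h *: 1 + t) - x t)) i 0) @ 0^' -->
    'D_1 x t i 0.
  have dc : h^-1 *: (x (h *: 1 + t) - x t) @[h --> 0^'] --> 'D_1 x t by exact: dx.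
  have cc : {for 'D_1 x t, continuous (fun M : 'cV[R]_p => M i 0)}.
    exact: coord_continuous.
  exact: (continuous_cvg _ cc dc).
have E : (fun h : R => (h^-1 *: (x (h *: 1 + t) - x t)) i 0) =
         (fun h : R => h^-1 *: (x (h *: 1 + t) i 0 - x t i 0)).
  by apply/funext => h; rewrite !mxE.
rewrite E in cx.
by apply: DeriveDef; [exact: cvgP cx|exact: cvg_lim cx].
Qed.

Lemma is_derive_sum_sqr (R : realType) (p : nat) (x : R -> 'cV[R]_p) (t : R) :
  derivable x t 1 ->
  is_derive t (1 : R) (fun s => \sum_i x s i 0 ^+ 2)
    (\sum_i (2 * x t i 0) * 'D_1 x t i 0).
Proof.
move=> dx.
have -> : (fun s => \sum_i x s i 0 ^+ 2) = \sum_i (fun s => x s i 0) ^+ 2.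
  by apply/funext => s; rewrite fct_sumE.
apply: is_derive_sum => i; have dxi := is_derive_coord i dx.
apply: is_derive_eq.
by rewrite /GRing.scale/= expr1.
Qed.

Section abs_continuous_paths.
Variables (R : realType) (p : nat) (x : R -> 'cV[R]_p).

Lemma abs_continuous_onW (a b c d : R) : c <= a -> b <= d ->
  abs_continuous_on c d x -> abs_continuous_on a b x.
Proof.
move=> ca bd acx e e0; have [delta d0 H] := acx e e0.
exists delta => // N u v uv; apply: H => i; have [au uv' vb] := uv i.
by split=> //; [exact: le_trans au|exact: le_trans bd].
Qed.

Lemma abs_continuous_coord (a b : R) (i : 'I_p) :
  abs_continuous_on a b x -> abs_continuous_real a b (fun s => x s i 0).
Proof.
move=> acx e e0; have [d d0 H] := acx e e0.
exists d => // N u v uv tuv len; apply: le_lt_trans (H N u v uv tuv len).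
apply: ler_sum => k _; apply: le_trans (coord_le_enorm _ i).
by rewrite !mxE.
Qed.

(** The sum of squares is Lipschitz on bounded sets. *)
Lemma abs_continuous_sum_sqr (a b K : R) :
  (forall t i, a <= t <= b -> `|x t i 0| <= K) ->
  abs_continuous_on a b x ->
  abs_continuous_real a b (fun s => \sum_i x s i 0 ^+ 2).
Proof.
move=> xK acx e e0.
pose M := \sum_(i < p) (K + K).
have hM (s t : R) : a <= s <= b -> a <= t <= b ->
    `|\sum_i x t i 0 ^+ 2 - \sum_i x s i 0 ^+ 2| <= enorm (x t - x s) * `|M|.
  move=> sab tab; rewrite -sumrB (le_trans (ler_norm_sum _ _ _))//.
  rewrite (@le_trans _ _ (enorm (x t - x s) * M))//; last first.
    by rewrite ler_wpM2l ?ler_norm ?sqrtr_ge0.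
  rewrite mulr_sumr; apply: ler_sum => i _.
  rewrite subr_sqr normrM ler_pM//.
    by rewrite (le_trans _ (coord_le_enorm _ i))// !mxE.
  by rewrite (le_trans (ler_normD _ _))// lerD// xK.
have M1 : 0 < `|M| + 1 by rewrite ltr_wpDl.
have [d d0 H] := acx (e / (`|M| + 1)) (divr_gt0 e0 M1).
exists d => // N u v uv tuv len; have {}H := H N u v uv tuv len.
rewrite ltr_pdivlMr// mulr_suml in H.
apply: le_lt_trans H; apply: ler_sum => k _; have [au uv' vb] := uv k.
apply: (le_trans (hM _ _ _ _)); first by rewrite au (le_trans uv').
  by rewrite (le_trans au).
by rewrite ler_wpM2l ?sqrtr_ge0// lerDl.
Qed.

(** Over a step of length [d / 2] each coordinate grows by at most 1 in size, and finitely many such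
    steps reach [T]. *)
Lemma abs_continuous_bounded (T : R) :
  0 <= T -> abs_continuous_on 0 T x ->
  exists K : R, forall t i, 0 <= t <= T -> `|x t i 0| <= K.
Proof.
move=> T0 acx; have [d d0 H] := acx 1 ltr01.
have step (s t : R) i : 0 <= s -> s <= t -> t <= T -> t - s < d ->
    `|x t i 0| <= `|x s i 0| + 1.
  move=> s0 st tT tsd.
  have : enorm (x t - x s) < 1.
    have := H 1 (fun=> s) (fun=> t); rewrite !big_ord1; apply=> //.
    by move=> j k _ _ _; rewrite !ord1.
  have := coord_le_enorm (x t - x s) i; rewrite !mxE => h1 h2.
  have := ler_normD (x s i 0) (x t i 0 - x s i 0).
  rewrite (addrC (x s i 0)) subrK; lra.
have chain k (t : R) i : 0 <= t <= T -> t <= k%:R * (d / 2) ->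
    `|x t i 0| <= `|x 0 i 0| + k%:R.
  elim: k t => [|k IH] t /andP[t0 tT].
    rewrite mul0r => t0'; have -> : t = 0 by apply/eqP; rewrite eq_le t0' t0.
    by rewrite addr0.
  rewrite -natr1 mulrDl mul1r => tk.
  have [tk'|tk'] := leP t (k%:R * (d / 2)).
    by have := IH t; rewrite t0 tT => /(_ isT tk'); lra.
  have [td|td] := leP t (d / 2).
    have := step 0 t i (lexx 0) t0 tT; rewrite subr0 => /(_ ltac:(lra)).
    by have := ler0n R k; lra.
  have := step (t - d / 2) t i ltac:(lra) ltac:(lra) tT ltac:(lra).
  have := IH (t - d / 2) ltac:(lra) ltac:(lra).
  by lra.
have [k hk] : exists k : nat, T <= k%:R * (d / 2).
  exists (Num.trunc (T / (d / 2))).+1.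
  rewrite -ler_pdivrMr ?divr_gt0//; apply: ltW.
  by rewrite truncnS_gt.
exists (\sum_i `|x 0 i 0| + k%:R) => t i tT.
apply: le_trans (chain k t i tT _) _.
  by case/andP: tT => _ tT; exact: le_trans hk.
by rewrite lerD2r (bigD1 i)//= lerDl sumr_ge0.
Qed.

End abs_continuous_paths.

Section filippov_solutions.
Variables (R : realType) (p : nat) (X : 'cV[R]_p -> 'cV[R]_p).
Variable x : R -> 'cV[R]_p.
Hypothesis hx : filippov_solution X x.

(** Integrated form of the chain rule for the energy. The bound is asked of every Filippov value, so
    it can be checked without knowing the derivative of [x]. *)
Lemma filippov_solution_sum_sqr (s t c : R) : 0 <= s -> s <= t ->
  (forall r, s < r < t -> forall v, filippov X (x r) v ->
     \sum_i (2 * x r i 0) * v i 0 <= c) ->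
  \sum_i x t i 0 ^+ 2 - \sum_i x s i 0 ^+ 2 <= c * (t - s).
Proof.
have [acx dx] := hx; move=> s0 st Hc.
(* Absolute continuity is only given up to positive times; here [t <= 0] forces [s = t]. *)
have [tpos|] := ltP 0 t; last first.
  move=> t0; have -> : s = t by apply/eqP; rewrite eq_le st (le_trans t0).
  by rewrite !subrr mulr0.
have [K hK] := abs_continuous_bounded (ltW tpos) (acx t tpos).
apply: (@abs_continuous_real_growth _ _ _ _ (fun r => \sum_i x r i 0 ^+ 2)) => //.
  apply: (@abs_continuous_sum_sqr _ _ _ _ _ K).
    by move=> r i /andP[sr rt]; apply: hK; rewrite (le_trans s0).
  exact: abs_continuous_onW s0 (lexx t) (acx t tpos).
apply: negligibleS dx; apply: subsetC => r /= Hr /andP[sr rt].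
have [|dxr vr] := Hr; first exact: le_lt_trans sr.
have dW := is_derive_sum_sqr dxr; split; first exact: ex_derive.
by rewrite derive_val; apply: Hc => //; rewrite sr.
Qed.

(** The growth lemma is applied to the coordinate and to its opposite. *)
Lemma filippov_solution_lipschitz (s t M : R) (i : 'I_p) : 0 <= s -> s <= t ->
  (forall r, s < r < t -> forall v, filippov X (x r) v -> `|v i 0| <= M) ->
  `|x t i 0 - x s i 0| <= M * (t - s).
Proof.
have [acx dx] := hx; move=> s0 st HM.
have [tpos|] := ltP 0 t; last first.
  move=> t0; have -> : s = t by apply/eqP; rewrite eq_le st (le_trans t0).
  by rewrite !subrr mulr0 normr0.
have acs := abs_continuous_onW s0 (lexx t) (acx t tpos).
have aci := abs_continuous_coord i acs.
have up : x t i 0 - x s i 0 <= M * (t - s).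
  apply: (@abs_continuous_real_growth _ _ _ _ (fun r => x r i 0)) => //.
  apply: negligibleS dx; apply: subsetC => r /= Hr /andP[sr rt].
  have [|dxr vr] := Hr; first exact: le_lt_trans sr.
  have dxi := is_derive_coord i dxr; split; first exact: ex_derive.
  rewrite derive_val (le_trans (ler_norm _))//; apply: HM vr.
  by rewrite sr.
have dn : - x t i 0 - - x s i 0 <= M * (t - s).
  apply: (@abs_continuous_real_growth _ _ _ _ (fun r => - x r i 0)) => //.
    move=> e e0; have [d d0 H] := aci e e0; exists d => // N u v h1 h2 h3.
    apply: le_lt_trans (H N u v h1 h2 h3); apply: ler_sum => k _.
    by rewrite -opprD normrN.
  apply: negligibleS dx; apply: subsetC => r /= Hr /andP[sr rt].
  have [|dxr vr] := Hr; first exact: le_lt_trans sr.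
  have dxi := is_derive_coord i dxr.
  have dxn : is_derive r (1 : R) (fun r => - x r i 0) (- 'D_1 x r i 0).
    exact: (@is_deriveN _ _ _ (fun r => x r i 0)).
  split; first exact: ex_derive.
  rewrite derive_val (le_trans (ler_norm _))// normrN; apply: HM vr.
  by rewrite sr.
by rewrite ler_norml; lra.
Qed.

End filippov_solutions.

(** * Convergence *)

(** The cube of radius [r] minus the [e]-neighbourhood of the set where [f <= 0] is compact, and [f]
    is positive on it; its minimum there serves as [eta]. *)
Lemma sublevel_near (R : realType) (n : nat) (f : 'rV[R]_n -> R) (r e : R) :
  continuous f -> 0 < e ->
  exists2 eta : R, 0 < eta & forall x : 'rV[R]_n, (forall i, `|x 0 i| <= r) ->
    f x < eta -> exists2 z, f z <= 0 & forall i, `|x 0 i - z 0 i| < e.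
Proof.
move=> cf e0.
pose U := \bigcup_(z in [set z | f z <= 0]) ball z e.
have oU : open U by apply: bigcup_open => z _; exact: ball_open.
pose K0 := [set u : 'rV[R]_n | forall i, `[- r, r]%classic (u ord0 i)].
have cK : compact (K0 `&` ~` U).
  apply: compact_closedI; last exact: open_closedC.
  by apply: (@rV_compact _ _ (fun=> `[- r, r]%classic)) => i; exact: segment_compact.
have inU (x : 'rV[R]_n) : U x -> exists2 z, f z <= 0 & forall i, `|x 0 i - z 0 i| < e.
  move=> [z fz [_ xz]]; exists z => // i.
  by rewrite distrC; have := xz 0 i; rewrite /ball/=.
have inK (x : 'rV[R]_n) : (forall i, `|x 0 i| <= r) -> K0 x.
  by move=> xr i; rewrite /= in_itv/= -ler_norml.
(* With nothing left outside the neighbourhood, any [eta] works. *)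
have [K00|/set0P Kn0] := eqVneq (K0 `&` ~` U) set0.
  exists 1 => // x /inK xK _; apply: inU; apply: contrapT => nU.
  by suff : set0 x by []; rewrite -K00.
have [c cK' cmin] := compact_EVT_min Kn0 cK (continuous_subspaceT cf).
move: cK'; rewrite inE => -[_ ncU].
exists (f c).
  by rewrite ltNge; apply/negP => fc; apply: ncU; exists c => //; exact: ballxx.
move=> x /inK xK fx; apply: inU; apply: contrapT => nU.
have := cmin x; rewrite inE leNgt fx => H.
by have : false by apply: H.
Qed.

(** The threshold is the supremum of the points where [g <= 0]. They include 0 by oddness and are
    bounded above because [g] is nonnegative on the right of 0 and unbounded in size. *)
Lemma monotone_odd_threshold (R : realType) (g : R -> R) :
  {homo g : y z / y <= z} -> (forall y, g y = - g (- y)) ->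
  `|g y| @[y --> +oo] --> +oo ->
  exists c, [/\ 0 <= c, forall y, y < c -> g y <= 0 & forall y, c < y -> 0 < g y].
Proof.
move=> gh go gl.
have g00 : g 0 = 0 by have := go 0; rewrite oppr0; lra.
have [Y [Yr HY]] : \forall y \near +oo, 1 <= `|g y| by move/cvgryPge: gl; exact.
pose E := [set y | g y <= 0].
have hsE : has_sup E.
  split; first by exists 0; rewrite /E/= g00.
  exists (Num.max 0 (Y + 1)) => y gy; rewrite leNgt; apply/negP.
  rewrite gt_max => /andP[y0 Yy].
  have : 0 <= g y by rewrite -g00 gh// ltW.
  move=> gy0; have := HY y ltac:(lra); rewrite ger0_norm//.
  by move: gy; rewrite /E/=; lra.
exists (sup E); split.
- by apply: ub_le_sup; [case: hsE|rewrite /E/= g00].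
- move=> y; rewrite -subr_gt0 => /(sup_adherent) /(_ hsE)[z gz]; rewrite subKr => yz.
  by apply: le_trans gz; rewrite gh// ltW.
- move=> y Ey; rewrite ltNge; apply/negP => gy.
  by move: Ey; rewrite ltNge => /negP; apply; apply: ub_le_sup => //; case: hsE.
Qed.

(** Left of a gap in [[- c k, c k]] arguments are below [c k], so [g k <= 0]; right of it they
    exceed [- c k], so [0 <= g k] by oddness. *)
Lemma setH1_sufficient (R : realType) (n m : nat) (src tgt : 'I_m -> 'I_n)
    (g : 'I_m -> R -> R) (c : 'I_m -> R) (z : 'cV[R]_n) :
  (forall k, src k != tgt k) ->
  (forall k y, g k y = - g k (- y)) ->
  (forall k y, y < c k -> g k y <= 0) ->
  (forall k, `|z (src k) 0 - z (tgt k) 0| <= c k) ->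
  setH1 (incidence R src tgt) g z.
Proof.
move=> st go gc zc k.
have Bz : ((col k (incidence R src tgt))^T *m z) 0 0 = z (src k) 0 - z (tgt k) 0.
  rewrite mxE (bigD1 (src k))//= (bigD1 (tgt k))/=; last by rewrite eq_sym.
  rewrite !mxE eqxx mul1r eq_sym (negbTE (st k)) eqxx mulN1r big1 ?addr0//.
  by move=> i /andP[i1 i2]; rewrite !mxE (negbTE i1) (negbTE i2) mul0r.
have := zc k; rewrite ler_norml => /andP[z1 z2].
apply: filippov_map1_0 => s; rewrite Bz => sz.
  by apply: gc; exact: lt_le_trans z2.
by rewrite go oppr_ge0 gc// ltrNl (le_lt_trans z1).
Qed.

Section consensus_solution.
Variables (R : realType) (n : nat) (A : 'M[R]_n) (gn : 'I_n -> 'I_n -> R -> R).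
Variable x : R -> 'cV[R]_n.
Hypotheses (hA : is_adjacency A)
  (gn_sym : forall i j, 0 < A i j -> gn i j = gn j i)
  (gn_homo : forall i j, 0 < A i j -> {homo gn i j : y z / y <= z})
  (gn_odd : forall i j, 0 < A i j -> forall y, gn i j (- y) = - gn i j y)
  (hx : filippov_solution (consensus_field A gn) x).

Let W t := \sum_i x t i 0 ^+ 2.

Lemma consensus_sum_sqr_nonincreasing (s t : R) : 0 <= s -> s <= t -> W t <= W s.
Proof.
move=> s0 st; rewrite -subr_le0 -[leRHS](mul0r (t - s)).
apply: (filippov_solution_sum_sqr hx s0 st) => r _ v.
exact: filippov_consensus_le0.
Qed.

Lemma consensus_solution_bounded (t : R) (i : 'I_n) :
  0 <= t -> `|x t i 0| <= enorm (x 0).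
Proof.
move=> t0; apply: (le_trans (coord_le_enorm _ _)).
by rewrite ler_wsqrtr//; exact: consensus_sum_sqr_nonincreasing.
Qed.

Lemma consensus_solution_lipschitz : exists2 M : R, 0 <= M &
  forall s t i, 0 <= s -> s <= t -> `|x t i 0 - x s i 0| <= M * (t - s).
Proof.
pose r := enorm (x 0); have [_ A0 _] := hA.
pose M i := \sum_j A i j * `|gn i j ((r + 1) + (r + 1))|.
have M0 i : 0 <= M i by apply: sumr_ge0 => j _; rewrite mulr_ge0.
exists (\sum_i M i); first exact: sumr_ge0.
move=> s t i s0 st; apply: (filippov_solution_lipschitz hx s0 st) => q.
move=> /andP[sq _] v vq; apply: (@le_trans _ _ (M i)).
  apply: filippov_consensus_bound vq => // j.
  by apply: consensus_solution_bounded; rewrite (le_trans s0)// ltW.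
by rewrite (bigD1 i)//= lerDl sumr_ge0.
Qed.

(** Take [T] where the energy is within [gamma * tau] of its infimum. A large gap at a later time
    would make the energy drop by [gamma * tau], below that infimum. *)
Lemma consensus_gap_eventually (i j : 'I_n) (c e : R) :
  0 < A i j -> 0 <= c -> 0 < e -> 0 < gn i j (c + e) ->
  exists2 T : R, 0 <= T & forall t, T <= t -> `|x t i 0 - x t j 0| < c + 3 * e.
Proof.
move=> Aij c0 e0 gpos.
have [M M0 HM] := consensus_solution_lipschitz.
(* Both ends of the edge move at speed at most [M], so the gap changes by at most [2 * M * tau <= e]
   during [tau]. The added 1 keeps the denominator positive if [M = 0]. *)
pose tau := e / (2 * M + 1).
have D0 : 0 < 2 * M + 1 by lra.
have tau0 : 0 < tau by rewrite divr_gt0.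
have Mtau : 2 * M * tau <= e.
  by rewrite /tau mulrCA ger_pMr// ler_pdivrMr// mul1r lerDl.
pose gamma := A i j * ((c + e + e) * gn i j (c + e)).
have gamma0 : 0 < gamma by rewrite !mulr_gt0//; lra.
pose E := [set W t | t in [set t | 0 <= t]].
have hE : has_inf E.
  split; first by exists (W 0), 0 => //=.
  by exists 0 => _ [t _ <-]; apply: sumr_ge0 => k _; exact: sqr_ge0.
have [_ [T T0 <-] WT] := inf_adherent (mulr_gt0 gamma0 tau0) hE.
exists T => // t Tt; rewrite ltNge; apply/negP => far.
have t0 : 0 <= t by exact: le_trans Tt.
have drop : W (t + tau) - W t <= - gamma * (t + tau - t).
  apply: (filippov_solution_sum_sqr hx t0); first by rewrite lerDl ltW.
  move=> r /andP[tr rt] v; apply: filippov_consensus_dissipation => //.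
  have Mr : M * (r - t) <= M * tau by rewrite ler_wpM2l//; lra.
  have := HM t r i t0 (ltW tr); have := HM t r j t0 (ltW tr).
  have [s1|s1] := lerP 0 (x t i 0 - x t j 0); last first.
    move: far; rewrite ltr0_norm// => far h1 h2.
    rewrite -normrN (le_trans _ (ler_norm _))//.
    by move: h1 h2; rewrite !ler_norml; lra.
  move: far; rewrite ger0_norm// => far h1 h2.
  rewrite (le_trans _ (ler_norm _))//.
  by move: h1 h2; rewrite !ler_norml; lra.
have low : inf E <= W (t + tau).
  by apply: ge_inf; [case: hE|exists (t + tau) => //=; rewrite addr_ge0// ltW].
have := consensus_sum_sqr_nonincreasing T0 Tt.
have tauE : t + tau - t = tau by rewrite addrC addKr.
by move: drop; rewrite tauE; lra.
Qed.

End consensus_solution.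

Lemma edist_set_ge0 (R : realType) (p : nat) (H : set 'cV[R]_p) (x : 'cV[R]_p) :
  (0 <= edist_set H x)%E.
Proof. by apply: le_ereal_inf_tmp => _ [z _ <-]; rewrite lee_fin sqrtr_ge0. Qed.

Lemma edist_set_cvg0 (R : realType) (p : nat) (H : set 'cV[R]_p)
    (x : R -> 'cV[R]_p) :
  (forall e, 0 < e -> exists T : R, forall t, T <= t ->
     exists2 z, H z & enorm (x t - z) <= e) ->
  edist_set H (x t) @[t --> +oo] --> 0%E.
Proof.
move=> near_H.
have le_e e : 0 < e -> \forall t \near +oo, (edist_set H (x t) <= e%:E)%E.
  move=> e0; have [T HT] := near_H e e0.
  near=> t; have [|z Hz xz] := HT t; first by near: t; exact: nbhs_pinfty_ge (num_real T).
  apply: (@le_trans _ _ (enorm (x t - z))%:E); last by rewrite lee_fin.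
  by apply: ereal_inf_lbound; exists z.
(* The distance is [+oo] for an empty set, so its finiteness at large times is proved first, from
   the bound 1. *)
apply/fine_cvgP; split.
  near=> t; rewrite ge0_fin_numE ?edist_set_ge0//.
  by apply: (@le_lt_trans _ _ 1%:E); [near: t; exact: le_e|exact: ltry].
apply/cvgrPdist_le => e e0; near=> t; rewrite sub0r normrN /=.
have le1 : (edist_set H (x t) <= e%:E)%E by near: t; exact: le_e.
rewrite ger0_norm ?fine_ge0 ?edist_set_ge0//.
rewrite -lee_fin fineK// ge0_fin_numE ?edist_set_ge0//.
exact: le_lt_trans le1 (ltry _).
Unshelve. all: by end_near. Qed.

Theorem mainTheorem3 (R : realType) (n m : nat) (A : 'M[R]_n)
    (src tgt : 'I_m -> 'I_n) (a : 'I_m -> R) (g : 'I_m -> R -> R)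
    (gn : 'I_n -> 'I_n -> R -> R) (x : R -> 'cV[R]_n)
    (hA : is_adjacency A)
    (hconn : connected_graph A)
    (hedge : is_orientation A src tgt)
    (ha : forall k, A (src k) (tgt k) = a k)
    (gincr : forall k, {homo g k : y z / y <= z})
    (godd : forall k y, g k y = - g k (- y))
    (glim : forall k, `|g k y| @[y --> +oo] --> +oo)
    (hgn : forall k, gn (src k) (tgt k) = g k /\ gn (tgt k) (src k) = g k)
    (hx : filippov_solution (consensus_field A gn) x) :
  edist_set (setH1 (incidence R src tgt) g) (x t) @[t --> +oo] --> 0%E.
Proof.
have [Apos edge] := hedge.
have gnE i j : 0 < A i j -> exists k, gn i j = g k /\ gn j i = g k.
  move=> /edge[k [[[<- <-]|[<- <-]] _]]; exists k; last split; case: (hgn k) => //.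
have gn_sym i j : 0 < A i j -> gn i j = gn j i by move=> /gnE[k [-> ->]].
have gn_homo i j : 0 < A i j -> {homo gn i j : y z / y <= z}.
  by move=> /gnE[k [-> _]]; exact: gincr.
have gn_odd i j : 0 < A i j -> forall y, gn i j (- y) = - gn i j y.
  by move=> /gnE[k [-> _]] y; rewrite [in RHS]godd opprK.
have st k : src k != tgt k.
  apply/eqP => e; have := Apos k; rewrite e; have [_ _ ->] := hA.
  by rewrite ltxx.
have [c hc] := choice (fun k => monotone_odd_threshold (gincr k) (godd k) (glim k)).
have c0 k : 0 <= c k by case: (hc k).
have clt k y : y < c k -> g k y <= 0 by case: (hc k) => _ h _; exact: h.
have cgt k y : c k < y -> 0 < g k y by case: (hc k) => _ _; exact.
(* [f] is the total excess of the gaps over their thresholds; [f u <= 0] puts [u] in the set by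
   [setH1_sufficient]. *)
pose gap (u : 'rV[R]_n) k := `|u 0 (src k) - u 0 (tgt k)| - c k.
pose f (u : 'rV[R]_n) := \sum_k Num.max 0 (gap u k).
have cf : continuous f.
  apply: continuous_sum => k u.
  apply: (@continuous_max _ _ (fun=> 0) (gap ^~ k)); first exact: cst_continuous.
  apply: (@continuousB _ _ _ (fun v : 'rV[R]_n => `|v 0 (src k) - v 0 (tgt k)|)
    (fun=> c k)); last exact: cst_continuous.
  apply: (@continuous_comp _ _ _ (fun v : 'rV[R]_n => v 0 (src k) - v 0 (tgt k))
    (fun y : R => `|y|)); last exact: norm_continuous.
  by apply: continuousB; exact: coord_continuous.
apply: edist_set_cvg0 => e e0.
have n1 : 0 < n%:R + 1 :> R by rewrite ltr_wpDl.
have m1 : 0 < m%:R + 1 :> R by rewrite ltr_wpDl.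
have [eta eta0 Heta] := @sublevel_near _ _ f (enorm (x 0)) (e / (n%:R + 1)) cf
  (divr_gt0 e0 n1).
(* Each of the [m] excesses will be at most [3 * d], for a total below [eta]. Likewise [n]
   coordinate errors below [e / (n + 1)] add up to at most [e]. *)
pose d := eta / (m%:R + 1) / 3.
have d0 : 0 < d by rewrite !divr_gt0.
have gapk k : exists T, 0 <= T /\ forall t, T <= t ->
    `|x t (src k) 0 - x t (tgt k) 0| < c k + 3 * d.
  have [|T T0 HT] := @consensus_gap_eventually _ _ _ _ _ hA gn_sym gn_homo gn_odd
    hx (src k) (tgt k) (c k) d (Apos k) (c0 k) d0.
    by have [-> _] := hgn k; apply: cgt; rewrite ltrDl.
  by exists T.
have [T HT] := choice gapk.
have T0 k : 0 <= T k by case: (HT k).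
(* The waiting times are nonnegative, so their sum dominates each of them. *)
exists (\sum_k T k) => t tT.
have t0 : 0 <= t by apply: le_trans tT; exact: sumr_ge0.
have xgap k : `|x t (src k) 0 - x t (tgt k) 0| < c k + 3 * d.
  have [_] := HT k; apply; apply: le_trans tT.
  by rewrite (bigD1 k)//= lerDl sumr_ge0.
have [||z fz xz] := Heta (x t)^T.
- move=> i; rewrite mxE.
  exact: (consensus_solution_bounded hA gn_sym gn_homo gn_odd hx).
- apply: (@le_lt_trans _ _ (\sum_(k < m) (3 * d))).
    apply: ler_sum => k _; rewrite ge_max /gap !mxE.
    by have := xgap k; lra.
  rewrite sumr_const card_ord -[(3 * d) *+ m]mulr_natr /d [3 * _]mulrC.
  rewrite divfK// mulrAC.
  by rewrite ltr_pdivrMr// ltr_pM2l// ltrDl.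
exists z^T.
  apply: (@setH1_sufficient _ _ _ _ _ _ c) => // k; rewrite !mxE.
  rewrite -subr_le0; apply: le_trans fz.
  apply: (@le_trans _ _ (Num.max 0 (gap z k))); first by rewrite le_max lexx orbT.
  rewrite /f (bigD1 k)//= lerDl sumr_ge0// => l _.
  by rewrite le_max lexx.
apply: (le_trans (enorm_le_sum _)).
apply: (@le_trans _ _ (\sum_(i < n) e / (n%:R + 1))).
  by apply: ler_sum => i _; rewrite !mxE; have := xz i; rewrite mxE; exact: ltW.
rewrite sumr_const card_ord -[_ *+ n]mulr_natr mulrAC ler_pdivrMr//.
by rewrite ler_pM2l// lerDl.
Qed.
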